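(* Let $n\ge 5$ be an odd integer. Then any (finite) region in the square lattice can be signed tiled by $\tilde{\mathcal{T}}_n$.
   Context: Work in the square lattice; a cell is a unit square, identified with the integer coordinates $(\alpha,\beta)\in\mathbb{Z}^2$ of its lower left corner. $\mathcal{T}_n=\{T_1,T_2,T_3,T_4\}$ is the set of ribbon $L$-shaped $n$-ominoes, where, as sets of $n$ cells, $T_1=\{(0,j):0\le j\le n-2\}\cup\{(1,0)\}$, $T_2=\{(1,j):0\le j\le n-2\}\cup\{(0,n-2)\}$, $T_3=\{(i,0):0\le i\le n-2\}\cup\{(0,1)\}$, $T_4=\{(i,1):0\le i\le n-2\}\cup\{(n-2,0)\}$. $\tilde{\mathcal{T}}_n$ consists of the four tiles of $\mathcal{T}_n$ together with the $2\times 2$ square $\{(0,0),(1,0),(0,1),(1,1)\}$. Only translates of the tiles by integer vectors are allowed. A region is a finite set of cells. A signed tiling of a region $R$ by $\tilde{\mathcal{T}}_n$ is a finite collection of translates of tiles of $\tilde{\mathcal{T}}_n$ (repetitions allowed), each with a weight $+1$ or $-1$, such that for every cell in $R$ the sum of the weights of the tiles covering it is $1$, and for every cell outside $R$ this sum is $0$. *)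

(* Defs.v *)
From mathcomp Require Import all_boot all_order all_algebra.
From mathcomp Require Import finmap.

Set Implicit Arguments.
Unset Strict Implicit.
Unset Printing Implicit Defensive.

Import GRing.Theory.

Local Open Scope fset_scope.
Local Open Scope ring_scope.

(* The unit square whose lower left corner is the given point. *)
Definition cell : Type := (int * int)%type.

Definition region : Type := {fset cell}.

(* [iota 0 n.-1] enumerates 0, ..., n - 2 (for n >= 1). *)
Definition tile1 (n : nat) : region :=
  [fset ((0 : int, j%:Z) : cell) | j in iota 0 n.-1] `|` [fset ((1, 0) : cell)].

Definition tile2 (n : nat) : region :=
  [fset ((1 : int, j%:Z) : cell) | j in iota 0 n.-1] `|`
  [fset ((0, (n - 2)%N%:Z) : cell)].

Definition tile3 (n : nat) : region :=
  [fset ((i%:Z, 0 : int) : cell) | i in iota 0 n.-1] `|` [fset ((0, 1) : cell)].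

Definition tile4 (n : nat) : region :=
  [fset ((i%:Z, 1 : int) : cell) | i in iota 0 n.-1] `|`
  [fset (((n - 2)%N%:Z, 0) : cell)].

Definition square2 : region :=
  [fset ((0, 0) : cell); ((1, 0) : cell); ((0, 1) : cell); ((1, 1) : cell)].

Definition ribbonL (n : nat) : seq region :=
  [:: tile1 n; tile2 n; tile3 n; tile4 n].

Definition ribbonL_square (n : nat) : seq region := rcons (ribbonL n) square2.

Definition translate (v : cell) (t : region) : region :=
  [fset (((v.1 + c.1)%R, (v.2 + c.2)%R) : cell) | c : cell in t].

(* Tile, integer shift, weight. *)
Definition weighted_tile : Type := (region * cell * int)%type.
Definition wt_tile (p : weighted_tile) : region := p.1.1.
Definition wt_shift (p : weighted_tile) : cell := p.1.2.
Definition wt_weight (p : weighted_tile) : int := p.2.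

Definition wt_cells (p : weighted_tile) : region :=
  translate (wt_shift p) (wt_tile p).

(* The finite collection is a list, so the same translate may occur several
   times, with equal or opposite weights. *)
Definition signed_tiling (tiles : seq region) (R : region)
    (s : seq weighted_tile) : Prop :=
  [/\ forall p : weighted_tile, p \in s -> wt_tile p \in tiles,
      forall p : weighted_tile, p \in s -> wt_weight p = 1 \/ wt_weight p = -1,
      forall c : cell, c \in R ->
        \sum_(p <- s | c \in wt_cells p) wt_weight p = 1
    & forall c : cell, c \notin R ->
        \sum_(p <- s | c \in wt_cells p) wt_weight p = 0].

Definition signed_tileable (tiles : seq region) (R : region) : Prop :=
  exists s : seq weighted_tile, signed_tiling tiles R s.

(* Main.v *)
Require Import Defs.
From mathcomp Require Import all_boot all_order all_algebra.
From mathcomp Require Import finmap.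
From mathcomp Require Import zify.

(** Identify a finitely supported integer function on cells with a Laurent
    polynomial in x, y, so that the signed-tileable functions form an ideal.
    Write m = n - 1, which is even.  Then 1 + x + ... + x^(m-1) is a multiple
    of 1 + x, so (1 + y) T3 is y (1 + y) plus a multiple of the square
    (1 + x)(1 + y); hence the vertical domino 1 + y lies in the ideal.
    Likewise T1 is x plus a multiple of 1 + y, so the ideal contains x, a
    unit. *)

Import GRing.Theory.
Local Open Scope fset_scope.
Local Open Scope ring_scope.

(** Allowing arbitrary integer values, not just 0 and 1, makes the notion closed under sums,
    differences and translation; in polynomial terms a translation is multiplication by a
    monomial. *)
Definition signed_tileable_fun (tiles : seq region) (f : cell -> int) : Prop :=
  exists s : seq weighted_tile,
    [/\ forall p, p \in s -> wt_tile p \in tiles,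
        forall p, p \in s -> wt_weight p = 1 \/ wt_weight p = -1
      & forall c, \sum_(p <- s | c \in wt_cells p) wt_weight p = f c].

Lemma mem_translate (v c : cell) (t : region) :
  (c \in translate v t) = (((c.1 - v.1, c.2 - v.2) : cell) \in t).
Proof.
apply/imfsetP/idP => [[d dt ->] /=|ct].
  by rewrite ![v.1 + _]addrC ![v.2 + _]addrC !addrK; case: d dt.
by exists (c.1 - v.1, c.2 - v.2) => //=; rewrite !subrKC; case: c ct.
Qed.

Lemma signed_tileable_indicator (tiles : seq region) (R : region) :
  signed_tileable_fun tiles (fun c => (c \in R)%:Z) -> signed_tileable tiles R.
Proof.
case=> s [st sw sc]; exists s; split=> // c cR; rewrite sc.
  by rewrite cR.
by rewrite (negbTE cR).
Qed.

Section SignedTileableFun.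

Variable tiles : seq region.
Implicit Types f g : cell -> int.

Lemma eq_signed_tileable f g :
  f =1 g -> signed_tileable_fun tiles f -> signed_tileable_fun tiles g.
Proof. by move=> fg [s [st sw sc]]; exists s; split=> // c; rewrite sc. Qed.

Lemma signed_tileable0 : signed_tileable_fun tiles (fun=> 0).
Proof. by exists [::]; split=> // c; rewrite big_nil. Qed.

Lemma signed_tileableD f g :
  signed_tileable_fun tiles f -> signed_tileable_fun tiles g ->
  signed_tileable_fun tiles (fun c => f c + g c).
Proof.
move=> [s [st sw sc]] [s' [st' sw' sc']]; exists (s ++ s'); split=> [p|p|c].
- by rewrite mem_cat => /orP[/st|/st'].
- by rewrite mem_cat => /orP[/sw|/sw'].
- by rewrite big_cat /= sc sc'.
Qed.

Lemma signed_tileableN f :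
  signed_tileable_fun tiles f -> signed_tileable_fun tiles (fun c => - f c).
Proof.
move=> [s [st sw sc]].
(* [p.1] holds both tile and shift, so the covered cells are unchanged and only the weight flips. *)
exists [seq (p.1, - p.2) | p <- s].
split=> [_ /mapP[p ps ->]|_ /mapP[p ps ->]|c].
- exact: (st p ps).
- rewrite /wt_weight /= -/(wt_weight p).
  by case: (sw p ps) => ->; [right | left].
- by rewrite big_map -sc -sumrN.
Qed.

Lemma signed_tileableB f g :
  signed_tileable_fun tiles f -> signed_tileable_fun tiles g ->
  signed_tileable_fun tiles (fun c => f c - g c).
Proof. by move=> tf /signed_tileableN; apply: signed_tileableD. Qed.

Lemma signed_tileable_shift (v : cell) f :
  signed_tileable_fun tiles f ->
  signed_tileable_fun tiles (fun c => f (c.1 - v.1, c.2 - v.2)).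
Proof.
move=> [s [st sw sc]].
pose mv (p : weighted_tile) : weighted_tile :=
  (wt_tile p, ((wt_shift p).1 + v.1, (wt_shift p).2 + v.2), wt_weight p).
exists [seq mv p | p <- s]; split=> [_ /mapP[p ps ->]|_ /mapP[p ps ->]|c].
- exact: (st p ps).
- exact: (sw p ps).
- rewrite big_map -sc; apply: eq_bigl => p.
  by rewrite /wt_cells !mem_translate /= !opprD !addrA
    ![_ - v.1]addrAC ![_ - v.2]addrAC.
Qed.

Lemma signed_tileable_tile (t : region) :
  t \in tiles -> signed_tileable_fun tiles (fun c => (c \in t)%:Z).
Proof.
move=> tt; exists [:: (t, (0, 0), 1)]; split=> [p|p|[a b]].
- by rewrite inE => /eqP->.
- by rewrite inE => /eqP->; left.
- by rewrite big_mkcond big_seq1 /wt_cells mem_translate /= !subr0; case: (_ \in t).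
Qed.

(** Build the region one cell at a time: each new cell contributes a translate of the origin's
    indicator. *)
Lemma signed_tileable_region (R : region) :
  signed_tileable_fun tiles (fun c => (c == (0, 0))%:Z) ->
  signed_tileable_fun tiles (fun c => (c \in R)%:Z).
Proof.
move=> cell0; elim/fset1U_rect: R => [|d R dR IH].
  exact: eq_signed_tileable signed_tileable0.
apply: eq_signed_tileable (signed_tileableD _ _ (signed_tileable_shift d _ cell0) IH).
move=> c /=; have -> : ((c.1 - d.1, c.2 - d.2) == (0, 0) :> cell) = (c == d).
  by case: c d {dR} => [a b] [a' b']; rewrite !xpair_eqE !subr_eq0.
(* The indicators add without overlap because [d] is not in [R]. *)
by rewrite in_fset1U; case: eqVneq => [->|]; rewrite ?(negbTE dR) ?addr0 ?add0r.
Qed.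

End SignedTileableFun.

(** With membership expressed by coordinate inequalities, the pointwise identities between tilings
    below reduce to linear arithmetic. *)
Lemma mem_tile1 (n : nat) (a b : int) :
  (((a, b) : cell) \in tile1 n) =
  (a == 0) && (0 <= b < n.-1%:Z) || (a == 1) && (b == 0).
Proof.
rewrite /tile1 inE in_fset1 xpair_eqE; congr (_ || _).
apply/imfsetP/idP => [[j]|].
  by rewrite /= mem_iota => jn [-> ->]; lia.
case: b => b; last by lia.
move=> /andP[/eqP-> bn]; exists b => //=; rewrite mem_iota; lia.
Qed.

Lemma mem_tile3 (n : nat) (a b : int) :
  (((a, b) : cell) \in tile3 n) =
  (b == 0) && (0 <= a < n.-1%:Z) || (a == 0) && (b == 1).
Proof.
rewrite /tile3 inE in_fset1 xpair_eqE; congr (_ || _).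
apply/imfsetP/idP => [[j]|].
  by rewrite /= mem_iota => jn [-> ->]; lia.
case: a => a; last by lia.
move=> /andP[/eqP-> an]; exists a => //=; rewrite mem_iota; lia.
Qed.

Lemma mem_square2 (a b : int) :
  (((a, b) : cell) \in square2) = (0 <= a < 2) && (0 <= b < 2).
Proof. rewrite /square2 !inE !xpair_eqE; lia. Qed.

Section EvenLegs.

Variables (tiles : seq region) (n : nat).
Hypothesis n_odd : odd n.
Hypotheses (tile1_in : tile1 n \in tiles) (tile3_in : tile3 n \in tiles).
Hypothesis square2_in : square2 \in tiles.

(** Squares placed side by side at even abscissas fill the strip. *)
Lemma signed_tileable_2xeven (k : nat) :
  signed_tileable_fun tiles
    (fun c => ((0 <= c.1 < k.*2%:Z) && (0 <= c.2 < 2))%:Z).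
Proof.
elim: k => [|k IH].
  by apply: eq_signed_tileable (signed_tileable0 tiles) => c /=; lia.
have sq := signed_tileable_shift _ (k.*2%:Z, 0) _ (signed_tileable_tile _ _ square2_in).
apply: eq_signed_tileable (signed_tileableD _ _ _ IH sq) => -[a b].
by rewrite mem_square2 /=; lia.
Qed.

Lemma signed_tileable_domino :
  signed_tileable_fun tiles (fun c => ((c.1 == 0) && (0 <= c.2 < 2))%:Z).
Proof.
have t3 := signed_tileable_tile _ _ tile3_in.
(* As [n] is odd, the strip has length exactly [n.-1], the length of the long leg of [tile3 n]. *)
have rect := signed_tileable_2xeven n.-1./2.
(* The tile and its translate one step up cover this strip together with the cells (0,1) and (0,2).
   Removing the strip leaves a vertical domino, one unit too high. *)
have y_domino := signed_tileableB _ _ _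
  (signed_tileableD _ _ _ t3 (signed_tileable_shift _ (0, 1) _ t3)) rect.
apply: eq_signed_tileable (signed_tileable_shift _ (0, -1) _ y_domino) => -[a b].
by rewrite !mem_tile3 /=; lia.
Qed.

Lemma signed_tileable_even_column (k : nat) :
  signed_tileable_fun tiles (fun c => ((c.1 == 0) && (0 <= c.2 < k.*2%:Z))%:Z).
Proof.
elim: k => [|k IH].
  by apply: eq_signed_tileable (signed_tileable0 tiles) => c /=; lia.
have dom := signed_tileable_shift _ (0, k.*2%:Z) _ signed_tileable_domino.
by apply: eq_signed_tileable (signed_tileableD _ _ _ IH dom) => -[a b] /=; lia.
Qed.

Lemma signed_tileable_cell0 :
  signed_tileable_fun tiles (fun c => (c == (0, 0))%:Z).
Proof.
(* The long leg of [tile1 n] has even height [n.-1], so stacked dominoes cancel it and only the foot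
   (1,0) survives; it is then moved to the origin. *)
have x_cell := signed_tileableB _ _ _ (signed_tileable_tile _ _ tile1_in)
  (signed_tileable_even_column n.-1./2).
apply: eq_signed_tileable (signed_tileable_shift _ (-1, 0) _ x_cell) => -[a b].
by rewrite mem_tile1 xpair_eqE /=; lia.
Qed.

End EvenLegs.

Theorem theorem7 (n : nat) (hn : (5 <= n)%N) (hodd : odd n) (R : region) :
  signed_tileable (ribbonL_square n) R.
Proof.
apply: signed_tileable_indicator; apply: signed_tileable_region.
apply: (@signed_tileable_cell0 _ n) => //; rewrite ?inE ?eqxx ?orbT //.
Qed.
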